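(* The category $\mathbf{2HA_\infty}$ of $2$-term $HA_\infty$-algebras and the category $\mathbf{HAss2}$ of hom-associative $2$-algebras are equivalent.
   Context: All vector spaces are over $\mathbb R$; twisting maps ($(\alpha_0,\alpha_1)$, resp. $\Phi$) are assumed not identically zero on both sides. Objects of $\mathbf{2HA_\infty}$: a $2$-term $HA_\infty$-algebra $(A_1\xrightarrow{d}A_0,\mu_2,\mu_3,\alpha_0,\alpha_1)$ consists of a linear map $d:A_1\to A_0$, bilinear maps $\mu_2:A_i\otimes A_j\to A_{i+j}$ (with $A_i=0$ for $i\ne0,1$), a trilinear map $\mu_3:A_0^{\otimes3}\to A_1$, and linear maps $\alpha_i:A_i\to A_i$ with $\alpha_0d=d\alpha_1$, $\alpha_1\mu_3=\mu_3\alpha_0^{\otimes3}$ such that for $a,b,c,e\in A_0$, $m,n\in A_1$: (a) $\mu_2(m,n)=0$; (b) $\alpha_0\mu_2(a,b)=\mu_2(\alpha_0a,\alpha_0b)$; (c) $\alpha_1\mu_2(a,m)=\mu_2(\alpha_0a,\alpha_1m)$; (d) $\alpha_1\mu_2(m,a)=\mu_2(\alpha_1m,\alpha_0a)$; (e) $d\mu_2(a,m)=\mu_2(a,dm)$; (f) $d\mu_2(m,a)=\mu_2(dm,a)$; (g) $\mu_2(dm,n)=\mu_2(m,dn)$; (h) $d\mu_3(a,b,c)=\mu_2(\mu_2(a,b),\alpha_0c)-\mu_2(\alpha_0a,\mu_2(b,c))$; (i1) $\mu_3(a,b,dm)=\mu_2(\mu_2(a,b),\alpha_1m)-\mu_2(\alpha_0a,\mu_2(b,m))$;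 (i2) $\mu_3(a,dm,c)=\mu_2(\mu_2(a,m),\alpha_0c)-\mu_2(\alpha_0a,\mu_2(m,c))$; (i3) $\mu_3(dm,b,c)=\mu_2(\mu_2(m,b),\alpha_0c)-\mu_2(\alpha_1m,\mu_2(b,c))$; (j) $\mu_3(\mu_2(a,b),\alpha_0c,\alpha_0e)-\mu_3(\alpha_0a,\mu_2(b,c),\alpha_0e)+\mu_3(\alpha_0a,\alpha_0b,\mu_2(c,e))=\mu_2(\mu_3(a,b,c),\alpha_0^2e)+\mu_2(\alpha_0^2a,\mu_3(b,c,e))$. Morphisms of $\mathbf{2HA_\infty}$: $f=(f_0,f_1,f_2):A\to A'$ with linear $f_0:A_0\to A_0'$, $f_1:A_1\to A_1'$, $f_0d=d'f_1$, $\alpha_i'f_i=f_i\alpha_i$ ($i=0,1$), and a bilinear $f_2:A_0\otimes A_0\to A_1'$ with $\alpha_1'f_2=f_2\alpha_0^{\otimes2}$, such that: $d'f_2(a,b)=f_0(\mu_2(a,b))-\mu_2'(f_0a,f_0b)$; $f_2(a,dm)=f_1(\mu_2(a,m))-\mu_2'(f_0a,f_1m)$; $f_2(dm,a)=f_1(\mu_2(m,a))-\mu_2'(f_1m,f_0a)$; and $f_2(\mu_2(a,b),\alpha_0c)-f_2(\alpha_0a,\mu_2(b,c))+\mu_2'(f_2(a,b),\alpha_0'f_0c)-\mu_2'(\alpha_0'f_0a,f_2(b,c))=f_1(\mu_3(a,b,c))-\mu_3'(f_0a,f_0b,f_0c)$. Composition: $(g\circ f)_0=g_0f_0$, $(g\circ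 f)_1=g_1f_1$, $(g\circ f)_2(a,b)=g_2(f_0a,f_0b)+g_1(f_2(a,b))$; identities are $(\mathrm{id},\mathrm{id},0)$. A $2$-vector space $C$ is a category internal to vector spaces: vector spaces $C_0$ of objects and $C_1$ of arrows with all structure maps (source, target, identities, composition) linear. A linear functor is a functor internal to vector spaces, i.e. linear on objects and on arrows. A bilinear functor $C\otimes C\to C$ means a functor $C\times C\to C$ bilinear on objects and on arrows; multilinear natural transformations are natural transformations depending multilinearly on the objects. Objects of $\mathbf{HAss2}$: a hom-associative $2$-algebra $(C,\mu,\Phi,\mathcal A)$ is a $2$-vector space $C$ with a bilinear functor $\mu:C\otimes C\to C$, a linear functor $\Phi=(\Phi_0,\Phi_1):C\to C$ with $\Phi(\mu(\xi,\eta))=\mu(\Phi(\xi),\Phi(\eta))$ (on objects and arrows), and a trilinear natural isomorphism $\mathcal A_{\xi,\eta,\zeta}:\mu(\mu(\xi,\eta),\Phi(\zeta))\to\mu(\Phi(\xi),\mu(\eta,\zeta))$ with $\mathcal A_{\Phi_0\xi,\Phi_0\eta,\Phi_0\zeta}=\Phi_1\mathcal A_{\xi,\eta,\zeta}$, such that for all objects $\xi,\eta,\zeta,\lambda$ the following two composite arrows $\mu(\mu(\mu(\xi,\eta),\Phi_0\zeta),\Phi_0^2\lambda)\to\mu(\Phi_0^2\xi,\mu(\Phi_0\eta,\mu(\zeta,\lambda)))$ coincide: $\mu(\mathcal A_{\xi,\eta,\zeta},1_{\Phi_0^2\lambda})$ followed by $\mathcal A_{\Phi_0\xi,\mu(\eta,\zeta),\Phi_0\lambda}$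 followed by $\mu(1_{\Phi_0^2\xi},\mathcal A_{\eta,\zeta,\lambda})$; and $\mathcal A_{\mu(\xi,\eta),\Phi_0\zeta,\Phi_0\lambda}$ followed by $\mathcal A_{\Phi_0\xi,\Phi_0\eta,\mu(\zeta,\lambda)}$. Morphisms of $\mathbf{HAss2}$: $F=(F_0,F_1,F_2):C\to C'$, where $(F_0,F_1)$ is a linear functor with $\Phi'\circ(F_0,F_1)=(F_0,F_1)\circ\Phi$, and $F_2(\xi,\eta):\mu'(F_0\xi,F_0\eta)\to F_0(\mu(\xi,\eta))$ is a bilinear natural transformation with $F_2(\Phi_0\xi,\Phi_0\eta)=\Phi_1'(F_2(\xi,\eta))$, such that the following composites from $\mu'(\mu'(F_0\xi,F_0\eta),\Phi'F_0\zeta)$ to $F_0(\mu(\Phi\xi,\mu(\eta,\zeta)))$ coincide: $\mathcal A'_{F_0\xi,F_0\eta,F_0\zeta}$ followed by $\mu'(1_{\Phi'F_0\xi},F_2(\eta,\zeta))$ followed by $F_2(\Phi\xi,\mu(\eta,\zeta))$; and $\mu'(F_2(\xi,\eta),1_{\Phi'F_0\zeta})$ followed by $F_2(\mu(\xi,\eta),\Phi\zeta)$ followed by $F_1(\mathcal A_{\xi,\eta,\zeta})$. Composition: $(G\circ F)_0=G_0F_0$, $(G\circ F)_1=G_1F_1$, and $(G\circ F)_2(\xi,\eta)$ is $G_2(F_0\xi,F_0\eta)$ followed by $G_1(F_2(\xi,\eta))$; identities are identity functors with identity transformations. *)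

(* Defs.v *)
From HB Require Import structures.
From mathcomp Require Import all_boot all_algebra.
From mathcomp Require Import boolp.

Set Implicit Arguments.
Unset Strict Implicit.
Unset Printing Implicit Defensive.

Import GRing.Theory.
Local Open Scope ring_scope.

Record category := Category {
  obj :> Type;
  hom : obj -> obj -> Type;
  idm : forall a, hom a a;
  compm : forall a b c, hom b c -> hom a b -> hom a c;
  compm_idl : forall a b (f : hom a b), compm (idm b) f = f;
  compm_idr : forall a b (f : hom a b), compm f (idm a) = f;
  compmA : forall a b c d (h : hom c d) (g : hom b c) (f : hom a b),
    compm h (compm g f) = compm (compm h g) f
}.
Arguments hom {_}.
Arguments idm {_}.

Record functor (C D : category) := Functor {
  fobj :> C -> D;
  fmap : forall a b, hom a b -> hom (fobj a) (fobj b);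
  fmap_id : forall a, fmap (idm a) = idm (fobj a);
  fmap_comp : forall a b c (g : hom b c) (f : hom a b),
    fmap (compm g f) = compm (fmap g) (fmap f)
}.

Definition id_functor (C : category) : functor C C :=
  @Functor C C id (fun _ _ => id) (fun _ => erefl) (fun _ _ _ _ _ => erefl).

Lemma comp_functor_id (C D E : category) (G : functor D E) (F : functor C D) a :
  fmap G (fmap F (idm a)) = idm (G (F a)).
Proof. by rewrite !fmap_id. Qed.

Lemma comp_functor_comp (C D E : category) (G : functor D E) (F : functor C D)
    (a b c : C) (g : hom b c) (f : hom a b) :
  fmap G (fmap F (compm g f)) = compm (fmap G (fmap F g)) (fmap G (fmap F f)).
Proof. by rewrite !fmap_comp. Qed.

Definition comp_functor (C D E : category) (G : functor D E) (F : functor C D) :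
    functor C E :=
  Functor (comp_functor_id G F) (@comp_functor_comp _ _ _ G F).

Definition is_iso (C : category) (a b : C) (f : hom a b) : Prop :=
  exists g : hom b a, compm g f = idm a /\ compm f g = idm b.

Definition naturally_isomorphic (C D : category) (F G : functor C D) : Prop :=
  exists eta : forall a, hom (F a) (G a),
    (forall a, is_iso (eta a)) /\
    (forall a b (f : hom a b),
       compm (eta b) (fmap F f) = compm (fmap G f) (eta a)).

Definition equivalent_categories (C D : category) : Prop :=
  exists (F : functor C D) (G : functor D C),
    naturally_isomorphic (comp_functor G F) (id_functor C) /\
    naturally_isomorphic (comp_functor F G) (id_functor D).

Definition trilinear (K : fieldType) (U V W X : lmodType K)
    (f : U -> V -> W -> X) : Prop :=
  [/\ forall v w, linear (fun u => f u v w),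
      forall u w, linear (fun v => f u v w)
    & forall u v, linear (fun w => f u v w)].

Lemma linear_ext (K : fieldType) (U V : lmodType K) (f g : {linear U -> V}) :
  f =1 g -> f = g.
Proof.
move=> /funext; case: f g => [f cf] [g cg] /= fg; subst g.
congr (GRing.Linear.Pack _).
case: cf cg => [[[a b]] [c]] [[[a1 b1]] [c1]].
by rewrite (Prop_irrelevance a a1) (Prop_irrelevance b b1)
  (Prop_irrelevance c c1).
Qed.

Lemma bilinear_ext (K : fieldType) (U V W : lmodType K)
    (f g : {bilinear U -> V -> W}) : f =2 g -> f = g.
Proof.
move=> fg; have {fg} : f = g :> (U -> V -> W).
  by apply/funext => u; apply/funext => v; exact: fg.
case: f g => [f cf] [g cg] /= fg; subst g.
congr (Bilinear.Pack _).
case: cf cg => [[a b c e]] [[a1 b1 c1 e1]].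
by rewrite (Prop_irrelevance a a1) (Prop_irrelevance b b1)
  (Prop_irrelevance c c1) (Prop_irrelevance e e1).
Qed.

Section BilinearConstructions.
Variables (K : fieldType).

Lemma bilin0_subproof (U V W : lmodType K) :
  bilinear_for *:%R *:%R (fun (_ : U) (_ : V) => 0 : W).
Proof. by split=> c k a b; rewrite /= scaler0 addr0. Qed.

Definition bilin0 (U V W : lmodType K) : {bilinear U -> V -> W} :=
  HB.pack (fun (_ : U) (_ : V) => 0 : W)
    (@bilinear_isBilinear.Build K U V W *:%R *:%R _ (@bilin0_subproof U V W)).

Definition lin_bilin_fun (U W W' : lmodType K) (q : {linear W -> W'})
  (f : {bilinear U -> U -> W}) (a b : U) := q (f a b).

Lemma lin_bilin_subproof (U W W' : lmodType K) (q : {linear W -> W'}) (f : {bilinear U -> U -> W}) :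
  bilinear_for *:%R *:%R (@lin_bilin_fun U W W' q f).
Proof.
by split=> c k a b; rewrite /lin_bilin_fun /= ?(linearPl, linearPr) linearP.
Qed.

Definition lin_bilin (U W W' : lmodType K) (q : {linear W -> W'}) (f : {bilinear U -> U -> W}) : {bilinear U -> U -> W'} :=
  HB.pack (@lin_bilin_fun U W W' q f)
    (@bilinear_isBilinear.Build K U U W' *:%R *:%R _ (lin_bilin_subproof q f)).

Definition bilin_lin_fun (U U' W : lmodType K) (g : {bilinear U' -> U' -> W})
  (p : {linear U -> U'}) (a b : U) := g (p a) (p b).

Lemma bilin_lin_subproof (U U' W : lmodType K) (g : {bilinear U' -> U' -> W}) (p : {linear U -> U'}) :
  bilinear_for *:%R *:%R (@bilin_lin_fun U U' W g p).
Proof.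
by split=> c k a b; rewrite /bilin_lin_fun /= linearP ?(linearPl, linearPr).
Qed.

Definition bilin_lin (U U' W : lmodType K) (g : {bilinear U' -> U' -> W}) (p : {linear U -> U'}) : {bilinear U -> U -> W} :=
  HB.pack (@bilin_lin_fun U U' W g p)
    (@bilinear_isBilinear.Build K U U W *:%R *:%R _ (bilin_lin_subproof g p)).

Definition bilin_add_fun (U W : lmodType K) (f g : {bilinear U -> U -> W})
  (a b : U) := f a b + g a b.

Lemma bilin_add_subproof (U W : lmodType K) (f g : {bilinear U -> U -> W}) :
  bilinear_for *:%R *:%R (@bilin_add_fun U W f g).
Proof.
by split=> c k a b; rewrite /bilin_add_fun /= ?(linearPl, linearPr) scalerDr addrACA.
Qed.

Definition bilin_add (U W : lmodType K) (f g : {bilinear U -> U -> W}) : {bilinear U -> U -> W} :=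
  HB.pack (@bilin_add_fun U W f g)
    (@bilinear_isBilinear.Build K U U W *:%R *:%R _ (bilin_add_subproof f g)).

End BilinearConstructions.

Section HA2.
Variable K : fieldType.

(* mu_2 has three components, mu00, mu01 and mu10, indexed by the degrees of
   its arguments; the component on A_1 (x) A_1 takes values in A_2 = 0, so the
   axiom mu_2(m, n) = 0 carries no further data. *)
Record HA2 := MakeHA2 {
  A0 : lmodType K;
  A1 : lmodType K;
  d : {linear A1 -> A0};
  mu00 : {bilinear A0 -> A0 -> A0};
  mu01 : {bilinear A0 -> A1 -> A1};
  mu10 : {bilinear A1 -> A0 -> A1};
  mu3 : A0 -> A0 -> A0 -> A1;
  alpha0 : {linear A0 -> A0};
  alpha1 : {linear A1 -> A1};
  mu3_trilinear : trilinear mu3;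
  alpha_neq0 : ~ ((forall a, alpha0 a = 0) /\ (forall m, alpha1 m = 0));
  alpha_d : forall m, alpha0 (d m) = d (alpha1 m);
  alpha_mu3 : forall a b c,
    alpha1 (mu3 a b c) = mu3 (alpha0 a) (alpha0 b) (alpha0 c);
  alpha_mu00 : forall a b, alpha0 (mu00 a b) = mu00 (alpha0 a) (alpha0 b);
  alpha_mu01 : forall a m, alpha1 (mu01 a m) = mu01 (alpha0 a) (alpha1 m);
  alpha_mu10 : forall m a, alpha1 (mu10 m a) = mu10 (alpha1 m) (alpha0 a);
  d_mu01 : forall a m, d (mu01 a m) = mu00 a (d m);
  d_mu10 : forall m a, d (mu10 m a) = mu00 (d m) a;
  mu_d : forall m n, mu01 (d m) n = mu10 m (d n);
  d_mu3 : forall a b c,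
    d (mu3 a b c) = mu00 (mu00 a b) (alpha0 c) - mu00 (alpha0 a) (mu00 b c);
  mu3_d3 : forall a b m,
    mu3 a b (d m) = mu01 (mu00 a b) (alpha1 m) - mu01 (alpha0 a) (mu01 b m);
  mu3_d2 : forall a m c,
    mu3 a (d m) c = mu10 (mu01 a m) (alpha0 c) - mu01 (alpha0 a) (mu10 m c);
  mu3_d1 : forall m b c,
    mu3 (d m) b c = mu10 (mu10 m b) (alpha0 c) - mu10 (alpha1 m) (mu00 b c);
  mu3_coherence : forall a b c e,
    mu3 (mu00 a b) (alpha0 c) (alpha0 e) - mu3 (alpha0 a) (mu00 b c) (alpha0 e)
      + mu3 (alpha0 a) (alpha0 b) (mu00 c e)
    = mu10 (mu3 a b c) (alpha0 (alpha0 e)) + mu01 (alpha0 (alpha0 a)) (mu3 b c e)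
}.

End HA2.

Arguments d {K h}.
Arguments mu00 {K h}.
Arguments mu01 {K h}.
Arguments mu10 {K h}.
Arguments mu3 {K h}.
Arguments alpha0 {K h}.
Arguments alpha1 {K h}.

Section HA2Category.
Variable K : fieldType.

Record HA2_hom (A B : HA2 K) := MakeHA2Hom {
  f0 : {linear A0 A -> A0 B};
  f1 : {linear A1 A -> A1 B};
  f2 : {bilinear A0 A -> A0 A -> A1 B};
  hom_d : forall m, f0 (d m) = d (f1 m);
  hom_alpha0 : forall a, alpha0 (f0 a) = f0 (alpha0 a);
  hom_alpha1 : forall m, alpha1 (f1 m) = f1 (alpha1 m);
  hom_alpha2 : forall a b, alpha1 (f2 a b) = f2 (alpha0 a) (alpha0 b);
  d_f2 : forall a b, d (f2 a b) = f0 (mu00 a b) - mu00 (f0 a) (f0 b);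
  f2_d2 : forall a m, f2 a (d m) = f1 (mu01 a m) - mu01 (f0 a) (f1 m);
  f2_d1 : forall m a, f2 (d m) a = f1 (mu10 m a) - mu10 (f1 m) (f0 a);
  f2_coherence : forall a b c,
    f2 (mu00 a b) (alpha0 c) - f2 (alpha0 a) (mu00 b c)
      + mu10 (f2 a b) (alpha0 (f0 c)) - mu01 (alpha0 (f0 a)) (f2 b c)
    = f1 (mu3 a b c) - mu3 (f0 a) (f0 b) (f0 c)
}.

Lemma HA2_hom_ext (A B : HA2 K) (f g : HA2_hom A B) :
  f0 f =1 f0 g -> f1 f =1 f1 g -> f2 f =2 f2 g -> f = g.
Proof.
case: f g => [? ? ? ? ? ? ? ? ? ? ?] [? ? ? ? ? ? ? ? ? ? ?] /=.
move=> /linear_ext E0 /linear_ext E1 /bilinear_ext E2; subst.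
by congr MakeHA2Hom; exact: Prop_irrelevance.
Qed.

Lemma HA2_id_coherence (A : HA2 K) (a b c : A0 A) :
  0 - 0 + mu10 (0 : A1 A) (alpha0 c) - mu01 (alpha0 a) (0 : A1 A)
  = mu3 a b c - mu3 a b c.
Proof. by rewrite linear0l linear0r !subr0 addr0 subrr. Qed.

Definition HA2_id (A : HA2 K) : HA2_hom A A.
Proof.
apply: (@MakeHA2Hom A A idfun idfun (bilin0 _ _ _)) => //=.
- by move=> *; rewrite linear0.
- by move=> *; rewrite linear0 subrr.
- by move=> *; rewrite subrr.
- by move=> *; rewrite subrr.
- exact: HA2_id_coherence.
Defined.

Section Comp.
Variables (A B C : HA2 K) (g : HA2_hom B C) (f : HA2_hom A B).

Definition HA2_comp0 : {linear A0 A -> A0 C} := f0 g \o f0 f.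
Definition HA2_comp1 : {linear A1 A -> A1 C} := f1 g \o f1 f.
Definition HA2_comp2 : {bilinear A0 A -> A0 A -> A1 C} :=
  bilin_add (bilin_lin (f2 g) (f0 f)) (lin_bilin (f1 g) (f2 f)).

Lemma coherence_sum (V : zmodType) (x y u w p q s t v z : V) :
  (x + (p - v) + s) - (y + (q - z) + t) + (u + v) - (w + z)
  = (x - y + u - w) + (s - t + p - q).
Proof.
rewrite !opprD !opprK !addrA.
by rewrite [LHS](ACl (1*5*9*11*4*8*2*6*3*10*7*12)) /= addrNK addrK.
Qed.

Lemma HA2_comp2E a b : HA2_comp2 a b = f2 g (f0 f a) (f0 f b) + f1 g (f2 f a b).
Proof. by []. Qed.

Lemma HA2_comp_d2 a b :
  d (HA2_comp2 a b) = HA2_comp0 (mu00 a b) - mu00 (HA2_comp0 a) (HA2_comp0 b).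
Proof.
by rewrite HA2_comp2E linearD /= d_f2 -hom_d d_f2 linearB addrC addrA subrK.
Qed.

Lemma HA2_comp2_d2 a m : HA2_comp2 a (d m)
  = HA2_comp1 (mu01 a m) - mu01 (HA2_comp0 a) (HA2_comp1 m).
Proof.
by rewrite HA2_comp2E hom_d !f2_d2 linearB /= addrC addrA subrK.
Qed.

Lemma HA2_comp2_d1 m a : HA2_comp2 (d m) a
  = HA2_comp1 (mu10 m a) - mu10 (HA2_comp1 m) (HA2_comp0 a).
Proof.
by rewrite HA2_comp2E hom_d !f2_d1 linearB /= addrC addrA subrK.
Qed.

Lemma HA2_comp_coherence a b c :
  HA2_comp2 (mu00 a b) (alpha0 c) - HA2_comp2 (alpha0 a) (mu00 b c)
    + mu10 (HA2_comp2 a b) (alpha0 (HA2_comp0 c))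
    - mu01 (alpha0 (HA2_comp0 a)) (HA2_comp2 b c)
  = HA2_comp1 (mu3 a b c) - mu3 (HA2_comp0 a) (HA2_comp0 b) (HA2_comp0 c).
Proof.
have Ef := congr1 (f1 g) (f2_coherence f a b c).
have Eg := f2_coherence g (f0 f a) (f0 f b) (f0 f c).
have P : f0 f (mu00 a b) = mu00 (f0 f a) (f0 f b) + d (f2 f a b).
  by rewrite d_f2 addrC subrK.
have Q : f0 f (mu00 b c) = mu00 (f0 f b) (f0 f c) + d (f2 f b c).
  by rewrite d_f2 addrC subrK.
rewrite !HA2_comp2E /HA2_comp0 /HA2_comp1 /= P Q -!hom_alpha0.
rewrite ![f2 g (_ + _) _]linearDl ![f2 g _ (_ + _)]linearDr /= !f2_d1 !f2_d2.
rewrite -!hom_alpha0 ![mu10 (_ + _) _]linearDl ![mu01 _ (_ + _)]linearDr /=.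
rewrite linearB !linearD linearN /= in Ef; rewrite coherence_sum Eg Ef.
by rewrite [f1 g (- _)]linearN /= addrC addrA subrK.
Qed.

Definition HA2_comp : HA2_hom A C.
Proof.
apply: (@MakeHA2Hom A C HA2_comp0 HA2_comp1 HA2_comp2) => *.
- by rewrite /= !hom_d.
- by rewrite /= !hom_alpha0.
- by rewrite /= !hom_alpha1.
- by rewrite !HA2_comp2E linearD /= hom_alpha1 !hom_alpha2 !hom_alpha0.
- exact: HA2_comp_d2.
- exact: HA2_comp2_d2.
- exact: HA2_comp2_d1.
- exact: HA2_comp_coherence.
Defined.

Lemma HA2_compE a b :
  f2 HA2_comp a b = f2 g (f0 f a) (f0 f b) + f1 g (f2 f a b).
Proof. by []. Qed.

End Comp.

Lemma HA2_comp_idl (A B : HA2 K) (f : HA2_hom A B) : HA2_comp (HA2_id B) f = f.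
Proof. by apply: HA2_hom_ext => // a b; rewrite HA2_compE add0r. Qed.

Lemma HA2_comp_idr (A B : HA2 K) (f : HA2_hom A B) : HA2_comp f (HA2_id A) = f.
Proof. by apply: HA2_hom_ext => // a b; rewrite HA2_compE linear0 addr0. Qed.

Lemma HA2_compA (A B C D : HA2 K) (h : HA2_hom C D) (g : HA2_hom B C)
    (f : HA2_hom A B) :
  HA2_comp h (HA2_comp g f) = HA2_comp (HA2_comp h g) f.
Proof.
by apply: HA2_hom_ext => // a b; rewrite !HA2_compE linearD addrA.
Qed.

Definition HA2_category : category :=
  Category HA2_comp_idl HA2_comp_idr HA2_compA.

End HA2Category.

(* A category internal to vector spaces.  Composition is diagrammatic:
   [comp f g H] is "f followed by g".  It is defined on the pullback of tgt and
   src, the subspace of composable pairs of ar * ar, and comp_linear states its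
   linearity there; in the axioms of the records below, proofs of composability
   which follow from the other axioms are universally quantified. *)
Record two_vect (K : fieldType) := TwoVect {
  ob : lmodType K;
  ar : lmodType K;
  src : {linear ar -> ob};
  tgt : {linear ar -> ob};
  idt : {linear ob -> ar};
  comp : forall f g : ar, tgt f = src g -> ar;
  comp_linear : forall (k : K) (f g f' g' : ar) (H : tgt f = src g)
    (H' : tgt f' = src g') (H'' : tgt (k *: f + f') = src (k *: g + g')),
    comp H'' = k *: comp H + comp H';
  src_idt : forall x, src (idt x) = x;
  tgt_idt : forall x, tgt (idt x) = x;
  src_comp : forall f g (H : tgt f = src g), src (comp H) = src f;
  tgt_comp : forall f g (H : tgt f = src g), tgt (comp H) = tgt g;
  comp_idl : forall f (H : tgt (idt (src f)) = src f), comp H = f;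
  comp_idr : forall f (H : tgt f = src (idt (tgt f))), comp H = f;
  compA : forall f g h (Hfg : tgt f = src g) (Hgh : tgt g = src h)
    (H : tgt (comp Hfg) = src h) (H' : tgt f = src (comp Hgh)),
    comp H = comp H'
}.

Arguments src {K t}.
Arguments tgt {K t}.
Arguments idt {K t}.
Arguments comp {K t} f g H.

Section TwoVect.
Variable K : fieldType.
Implicit Types C D E : two_vect K.

Definition invertible C (f : ar C) : Prop :=
  exists (g : ar C) (H : tgt f = src g) (H' : tgt g = src f),
    comp f g H = idt (src f) /\ comp g f H' = idt (tgt f).

Definition comp3 C (f g h : ar C) (H : tgt f = src g) (H' : tgt g = src h) :=
  comp (comp f g H) h (etrans (tgt_comp H) H').
Arguments comp3 {C} f g h H H'.

Record linear_functor C D := LinearFunctor {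
  lf0 : {linear ob C -> ob D};
  lf1 : {linear ar C -> ar D};
  src_lf : forall f, src (lf1 f) = lf0 (src f);
  tgt_lf : forall f, tgt (lf1 f) = lf0 (tgt f);
  lf_idt : forall x, lf1 (idt x) = idt (lf0 x);
  lf_comp : forall f g (H : tgt f = src g) (H' : tgt (lf1 f) = src (lf1 g)),
    lf1 (comp f g H) = comp (lf1 f) (lf1 g) H'
}.

(* A functor C x D -> E, bilinear on objects and on arrows. *)
Record bilinear_functor C D E := BilinearFunctor {
  bf0 : {bilinear ob C -> ob D -> ob E};
  bf1 : {bilinear ar C -> ar D -> ar E};
  src_bf : forall f g, src (bf1 f g) = bf0 (src f) (src g);
  tgt_bf : forall f g, tgt (bf1 f g) = bf0 (tgt f) (tgt g);
  bf_idt : forall x y, bf1 (idt x) (idt y) = idt (bf0 x y);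
  bf_comp : forall f f' g g' (Hf : tgt f = src f') (Hg : tgt g = src g')
    (H : tgt (bf1 f g) = src (bf1 f' g')),
    bf1 (comp f f' Hf) (comp g g' Hg) = comp (bf1 f g) (bf1 f' g') H
}.

End TwoVect.

Arguments comp3 {K C} f g h H H'.

(* The data of a hom-associative 2-algebra, together with the sources and
   targets of the arrows [assoc x y z] and the multiplicativity of Phi, which
   are needed to write down the composites in the remaining axioms. *)
Record hass2_data (K : fieldType) := HAss2Data {
  cat2 :> two_vect K;
  mu : bilinear_functor cat2 cat2 cat2;
  Phi : linear_functor cat2 cat2;
  assoc : ob cat2 -> ob cat2 -> ob cat2 -> ar cat2;
  Phi_mu0 : forall x y, lf0 Phi (bf0 mu x y) = bf0 mu (lf0 Phi x) (lf0 Phi y);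
  Phi_mu1 : forall f g, lf1 Phi (bf1 mu f g) = bf1 mu (lf1 Phi f) (lf1 Phi g);
  src_assoc : forall x y z,
    src (assoc x y z) = bf0 mu (bf0 mu x y) (lf0 Phi z);
  tgt_assoc : forall x y z,
    tgt (assoc x y z) = bf0 mu (lf0 Phi x) (bf0 mu y z)
}.

Notation mu0 C := (bf0 (mu C)).
Notation mu1 C := (bf1 (mu C)).
Notation Phi0 C := (lf0 (Phi C)).
Notation Phi1 C := (lf1 (Phi C)).
Arguments assoc {K h}.

Section HAss2.
Variable K : fieldType.

Section Composability.
Variable C : hass2_data K.

Lemma assoc_natural_l (f g h : ar C) :
  tgt (mu1 C (mu1 C f g) (Phi1 C h)) = src (assoc (tgt f) (tgt g) (tgt h)).
Proof. by rewrite src_assoc !tgt_bf tgt_lf. Qed.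

Lemma assoc_natural_r (f g h : ar C) :
  tgt (assoc (src f) (src g) (src h)) = src (mu1 C (Phi1 C f) (mu1 C g h)).
Proof. by rewrite tgt_assoc !src_bf src_lf. Qed.

Lemma pentagon_l1 (x y z w : ob C) :
  tgt (mu1 C (assoc x y z) (idt (Phi0 C (Phi0 C w))))
  = src (assoc (Phi0 C x) (mu0 C y z) (Phi0 C w)).
Proof. by rewrite tgt_bf tgt_assoc tgt_idt src_assoc. Qed.

Lemma pentagon_l2 (x y z w : ob C) :
  tgt (assoc (Phi0 C x) (mu0 C y z) (Phi0 C w))
  = src (mu1 C (idt (Phi0 C (Phi0 C x))) (assoc y z w)).
Proof. by rewrite src_bf tgt_assoc src_idt src_assoc. Qed.

Lemma pentagon_r (x y z w : ob C) :
  tgt (assoc (mu0 C x y) (Phi0 C z) (Phi0 C w))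
  = src (assoc (Phi0 C x) (Phi0 C y) (mu0 C z w)).
Proof. by rewrite tgt_assoc src_assoc !Phi_mu0. Qed.

End Composability.

Record hass2 := HAss2 {
  hdata :> hass2_data K;
  Phi_neq0 : ~ ((forall x : ob hdata, Phi0 hdata x = 0)
                /\ (forall f : ar hdata, Phi1 hdata f = 0));
  assoc_trilinear : trilinear (@assoc K hdata);
  assoc_natural : forall f g h : ar hdata,
    comp (mu1 hdata (mu1 hdata f g) (Phi1 hdata h))
         (assoc (tgt f) (tgt g) (tgt h)) (assoc_natural_l f g h)
    = comp (assoc (src f) (src g) (src h))
           (mu1 hdata (Phi1 hdata f) (mu1 hdata g h)) (assoc_natural_r f g h);
  assoc_invertible : forall x y z : ob hdata, invertible (assoc x y z);
  assoc_Phi : forall x y z : ob hdata,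
    assoc (Phi0 hdata x) (Phi0 hdata y) (Phi0 hdata z)
    = Phi1 hdata (assoc x y z);
  pentagon : forall x y z w : ob hdata,
    comp3 (mu1 hdata (assoc x y z) (idt (Phi0 hdata (Phi0 hdata w))))
          (assoc (Phi0 hdata x) (mu0 hdata y z) (Phi0 hdata w))
          (mu1 hdata (idt (Phi0 hdata (Phi0 hdata x))) (assoc y z w))
          (pentagon_l1 x y z w) (pentagon_l2 x y z w)
    = comp (assoc (mu0 hdata x y) (Phi0 hdata z) (Phi0 hdata w))
           (assoc (Phi0 hdata x) (Phi0 hdata y) (mu0 hdata z w))
           (pentagon_r x y z w)
}.

Record hass2_hom_data (C D : hass2) := HAss2HomData {
  hfun : linear_functor C D;
  F2 : {bilinear ob C -> ob C -> ar D};
  hfun_Phi0 : forall x, Phi0 D (lf0 hfun x) = lf0 hfun (Phi0 C x);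
  hfun_Phi1 : forall f, Phi1 D (lf1 hfun f) = lf1 hfun (Phi1 C f);
  src_F2 : forall x y, src (F2 x y) = mu0 D (lf0 hfun x) (lf0 hfun y);
  tgt_F2 : forall x y, tgt (F2 x y) = lf0 hfun (mu0 C x y)
}.

Section HomComposability.
Variables (C D : hass2) (F : hass2_hom_data C D).
Local Notation F0 := (lf0 (hfun F)).
Local Notation F1 := (lf1 (hfun F)).
Local Notation F2 := (F2 F).

Lemma F2_natural_l (f g : ar C) :
  tgt (mu1 D (F1 f) (F1 g)) = src (F2 (tgt f) (tgt g)).
Proof. by rewrite tgt_bf !tgt_lf src_F2. Qed.

Lemma F2_natural_r (f g : ar C) :
  tgt (F2 (src f) (src g)) = src (F1 (mu1 C f g)).
Proof. by rewrite tgt_F2 src_lf src_bf. Qed.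

Lemma hexagon_l1 (x y z : ob C) :
  tgt (assoc (F0 x) (F0 y) (F0 z))
  = src (mu1 D (idt (Phi0 D (F0 x))) (F2 y z)).
Proof. by rewrite tgt_assoc src_bf src_idt src_F2. Qed.

Lemma hexagon_l2 (x y z : ob C) :
  tgt (mu1 D (idt (Phi0 D (F0 x))) (F2 y z))
  = src (F2 (Phi0 C x) (mu0 C y z)).
Proof. by rewrite tgt_bf tgt_idt tgt_F2 src_F2 hfun_Phi0. Qed.

Lemma hexagon_r1 (x y z : ob C) :
  tgt (mu1 D (F2 x y) (idt (Phi0 D (F0 z))))
  = src (F2 (mu0 C x y) (Phi0 C z)).
Proof. by rewrite tgt_bf tgt_idt tgt_F2 src_F2 hfun_Phi0. Qed.

Lemma hexagon_r2 (x y z : ob C) :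
  tgt (F2 (mu0 C x y) (Phi0 C z)) = src (F1 (assoc x y z)).
Proof. by rewrite tgt_F2 src_lf src_assoc. Qed.

End HomComposability.

Record hass2_hom (C D : hass2) := HAss2Hom {
  hom_data :> hass2_hom_data C D;
  F2_natural : forall f g : ar C,
    comp (mu1 D (lf1 (hfun hom_data) f) (lf1 (hfun hom_data) g))
         (F2 hom_data (tgt f) (tgt g)) (F2_natural_l hom_data f g)
    = comp (F2 hom_data (src f) (src g))
           (lf1 (hfun hom_data) (mu1 C f g)) (F2_natural_r hom_data f g);
  F2_Phi : forall x y : ob C,
    F2 hom_data (Phi0 C x) (Phi0 C y) = Phi1 D (F2 hom_data x y);
  hexagon : forall x y z : ob C,
    comp3 (assoc (lf0 (hfun hom_data) x) (lf0 (hfun hom_data) y)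
                 (lf0 (hfun hom_data) z))
          (mu1 D (idt (Phi0 D (lf0 (hfun hom_data) x))) (F2 hom_data y z))
          (F2 hom_data (Phi0 C x) (mu0 C y z))
          (hexagon_l1 hom_data x y z) (hexagon_l2 hom_data x y z)
    = comp3 (mu1 D (F2 hom_data x y) (idt (Phi0 D (lf0 (hfun hom_data) z))))
            (F2 hom_data (mu0 C x y) (Phi0 C z))
            (lf1 (hfun hom_data) (assoc x y z))
            (hexagon_r1 hom_data x y z) (hexagon_r2 hom_data x y z)
}.

Lemma linear_functor_ext (C D : two_vect K) (F G : linear_functor C D) :
  lf0 F =1 lf0 G -> lf1 F =1 lf1 G -> F = G.
Proof.
case: F G => [? ? ? ? ? ?] [? ? ? ? ? ?] /= /linear_ext E0 /linear_ext E1.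
by subst; congr LinearFunctor; exact: Prop_irrelevance.
Qed.

Lemma hass2_hom_data_ext (C D : hass2) (F G : hass2_hom_data C D) :
  lf0 (hfun F) =1 lf0 (hfun G) -> lf1 (hfun F) =1 lf1 (hfun G) ->
  F2 F =2 F2 G -> F = G.
Proof.
case: F G => [F ? ? ? ? ?] [G ? ? ? ? ?] /= E0 E1 /bilinear_ext E2.
have EF := linear_functor_ext E0 E1; subst.
by congr HAss2HomData; exact: Prop_irrelevance.
Qed.

Lemma hass2_hom_ext (C D : hass2) (F G : hass2_hom C D) :
  lf0 (hfun F) =1 lf0 (hfun G) -> lf1 (hfun F) =1 lf1 (hfun G) ->
  F2 F =2 F2 G -> F = G.
Proof.
move=> E0 E1 E2; have := hass2_hom_data_ext E0 E1 E2.
case: F G {E0 E1 E2} => [F ? ? ?] [G ? ? ?] /= EFG; subst.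
by congr HAss2Hom; exact: Prop_irrelevance.
Qed.

(* By linearity, composition is determined by the rest of the structure; the
   formula below extends it to an associative operation on all arrows. *)
Definition seqa (C : two_vect K) (f g : ar C) : ar C := f + g - idt (src g).
Local Notation "f ∙ g" := (seqa f g) (at level 45, left associativity).

Lemma comp_congr (C : two_vect K) (f f' g g' : ar C) H H' :
  f = f' -> g = g' -> comp f g H = comp f' g' H'.
Proof. by move=> E E'; subst; congr comp; exact: Prop_irrelevance. Qed.

Lemma compE (C : two_vect K) (f g : ar C) H : comp f g H = f ∙ g.
Proof.
have H1 : tgt f = src (idt (tgt f)) by rewrite src_idt.
have H0 : tgt (idt (src (g - idt (src g)))) = src (g - idt (src g)).
  by rewrite tgt_idt.
have E0 : idt (src (g - idt (src g))) = 0 :> ar C.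
  by rewrite linearB /= src_idt subrr linear0.
have H3 : tgt (1 *: f + idt (src (g - idt (src g))))
          = src (1 *: idt (tgt f) + (g - idt (src g))).
  by rewrite E0 !scale1r addr0 H addrC subrK.
have := comp_linear H1 H0 H3; rewrite comp_idr comp_idl.
rewrite [X in _ = X + _]scale1r /seqa -addrA => <-; apply: comp_congr.
  by rewrite E0 scale1r addr0.
by rewrite scale1r H addrC subrK.
Qed.

Lemma seqaA (C : two_vect K) (f g h : ar C) : f ∙ (g ∙ h) = f ∙ g ∙ h.
Proof.
have E : src (g + h - idt (src h)) = src g.
  by rewrite linearB linearD /= src_idt addrK.
by rewrite /seqa E !addrA [LHS](ACl (1*2*5*3*4)).
Qed.

Lemma seqa_linear (C : two_vect K) (k : K) (f g f' g' : ar C) :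
  (k *: f + f') ∙ (k *: g + g') = k *: (f ∙ g) + f' ∙ g'.
Proof.
rewrite /seqa [src _]linearP [idt _]linearP /= scalerBr scalerDr opprD !addrA.
by rewrite [LHS](ACl (1*3*5*2*4*6)).
Qed.

Lemma seqa_idl (C : two_vect K) (f : ar C) x : src f = x -> idt x ∙ f = f.
Proof. by move=> <-; rewrite /seqa [X in X - _]addrC addrK. Qed.

Lemma seqa_idr (C : two_vect K) (f : ar C) x : f ∙ idt x = f.
Proof. by rewrite /seqa src_idt addrK. Qed.

Lemma lf_seqa (C D : two_vect K) (F : linear_functor C D) (f g : ar C) :
  lf1 F (f ∙ g) = lf1 F f ∙ lf1 F g.
Proof. by rewrite /seqa linearB linearD /= lf_idt src_lf. Qed.

Lemma bf_seqa (C D E : two_vect K) (M : bilinear_functor C D E)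
    (f f' : ar C) (g g' : ar D) : tgt f = src f' -> tgt g = src g' ->
  bf1 M (f ∙ f') (g ∙ g') = bf1 M f g ∙ bf1 M f' g'.
Proof.
move=> Hf Hg; have H : tgt (bf1 M f g) = src (bf1 M f' g').
  by rewrite tgt_bf src_bf Hf Hg.
by have := bf_comp Hf Hg H; rewrite !compE.
Qed.

Lemma F2_naturalE (C D : hass2) (F : hass2_hom C D) (f g : ar C) :
  mu1 D (lf1 (hfun F) f) (lf1 (hfun F) g) ∙ F2 F (tgt f) (tgt g)
  = F2 F (src f) (src g) ∙ lf1 (hfun F) (mu1 C f g).
Proof. by have := F2_natural F f g; rewrite !compE. Qed.

Lemma hexagonE (C D : hass2) (F : hass2_hom C D) (x y z : ob C) :
  assoc (lf0 (hfun F) x) (lf0 (hfun F) y) (lf0 (hfun F) z)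
    ∙ mu1 D (idt (Phi0 D (lf0 (hfun F) x))) (F2 F y z)
    ∙ F2 F (Phi0 C x) (mu0 C y z)
  = mu1 D (F2 F x y) (idt (Phi0 D (lf0 (hfun F) z)))
    ∙ F2 F (mu0 C x y) (Phi0 C z) ∙ lf1 (hfun F) (assoc x y z).
Proof. by have := hexagon F x y z; rewrite /comp3 !compE. Qed.

Definition id_linear_functor (C : two_vect K) : linear_functor C C.
Proof.
apply: (@LinearFunctor K C C idfun idfun) => //=.
by move=> f g H H'; congr comp; exact: Prop_irrelevance.
Defined.

Definition comp_linear_functor (C D E : two_vect K) (G : linear_functor D E)
  (F : linear_functor C D) : linear_functor C E.
Proof.
apply: (@LinearFunctor K C E (lf0 G \o lf0 F) (lf1 G \o lf1 F)) => /=.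
- by move=> f; rewrite !src_lf.
- by move=> f; rewrite !tgt_lf.
- by move=> x; rewrite !lf_idt.
- by move=> f g H H'; rewrite !compE !lf_seqa.
Defined.

Definition hass2_id_data (C : hass2) : hass2_hom_data C C.
Proof.
apply: (@HAss2HomData C C (id_linear_functor C) (lin_bilin idt (bf0 (mu C)))) => //=.
- by move=> x y; rewrite [LHS]src_idt.
- by move=> x y; rewrite [LHS]tgt_idt.
Defined.

Lemma hass2_id_F2 (C : hass2) x y : F2 (hass2_id_data C) x y = idt (mu0 C x y).
Proof. by []. Qed.

Definition hass2_id (C : hass2) : hass2_hom C C.
Proof.
apply: (@HAss2Hom C C (hass2_id_data C)).
- move=> f g; rewrite !compE !hass2_id_F2 seqa_idr seqa_idl //.
  by rewrite src_lf src_bf.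
- by move=> x y; rewrite !hass2_id_F2 lf_idt Phi_mu0.
- move=> x y z; rewrite /comp3 !compE !hass2_id_F2 !bf_idt !seqa_idr.
  by rewrite seqa_idl //= src_assoc.
Defined.

Section Comp.
Variables (C D E : hass2) (G : hass2_hom D E) (F : hass2_hom C D).
Local Notation F0 := (lf0 (hfun F)).
Local Notation F1 := (lf1 (hfun F)).
Local Notation G0 := (lf0 (hfun G)).
Local Notation G1 := (lf1 (hfun G)).

Lemma hass2_comp_F2_composable (x y : ob C) :
  tgt (F2 G (F0 x) (F0 y)) = src (G1 (F2 F x y)).
Proof. by rewrite tgt_F2 src_lf src_F2. Qed.

Definition hass2_comp_F2_fun (x y : ob C) : ar E :=
  comp (F2 G (F0 x) (F0 y)) (G1 (F2 F x y)) (hass2_comp_F2_composable x y).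

Lemma hass2_comp_F2_bilinear : bilinear_for *:%R *:%R hass2_comp_F2_fun.
Proof.
split=> c k a b; rewrite /hass2_comp_F2_fun !compE.
  by rewrite /= linearP !linearPl linearP /= seqa_linear.
by rewrite /= linearP !linearPr linearP /= seqa_linear.
Qed.

Definition hass2_comp_F2 : {bilinear ob C -> ob C -> ar E} :=
  HB.pack hass2_comp_F2_fun
    (@bilinear_isBilinear.Build K (ob C) (ob C) (ar E) *:%R *:%R _
       hass2_comp_F2_bilinear).

Lemma hass2_comp_F2E x y :
  hass2_comp_F2 x y = F2 G (F0 x) (F0 y) ∙ G1 (F2 F x y).
Proof. exact: compE. Qed.

Definition hass2_comp_data : hass2_hom_data C E.
Proof.
apply: (@HAss2HomData C E (comp_linear_functor (hfun G) (hfun F)) hass2_comp_F2).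
- by move=> x /=; rewrite !hfun_Phi0.
- by move=> f /=; rewrite !hfun_Phi1.
- by move=> x y; rewrite [LHS]src_comp src_F2.
- by move=> x y; rewrite [LHS]tgt_comp tgt_lf tgt_F2.
Defined.

Lemma hass2_comp_dataE x y :
  F2 hass2_comp_data x y = F2 G (F0 x) (F0 y) ∙ G1 (F2 F x y).
Proof. exact: compE. Qed.

Definition hass2_comp : hass2_hom C E.
Proof.
apply: (@HAss2Hom C E hass2_comp_data).
- move=> f g; rewrite !compE !hass2_comp_dataE /=.
  have := F2_naturalE G (F1 f) (F1 g); rewrite !src_lf !tgt_lf => NG.
  by rewrite seqaA NG -!seqaA -!lf_seqa F2_naturalE.
- move=> x y; rewrite !hass2_comp_dataE -!hfun_Phi0 !F2_Phi lf_seqa.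
  by rewrite hfun_Phi1.
- move=> x y z; rewrite /comp3 !compE !hass2_comp_dataE /=.
  set p := F2 G (F0 y) (F0 z); set q := G1 (F2 F y z).
  have Hpq : tgt p = src q by exact: hass2_comp_F2_composable.
set p' := F2 G (F0 x) (F0 y); set q' := G1 (F2 F x y).
have Hpq' : tgt p' = src q' by exact: hass2_comp_F2_composable.
set ux := idt (Phi0 E (G0 (F0 x))); set uz := idt (Phi0 E (G0 (F0 z))).
have Hu u : tgt (idt u : ar E) = src (idt u : ar E) by rewrite src_idt tgt_idt.
have -> : mu1 E ux (p ∙ q) = mu1 E ux p ∙ mu1 E ux q.
  by rewrite -{1}[ux](seqa_idr _ (Phi0 E (G0 (F0 x)))) bf_seqa //; exact: Hu.
have -> : mu1 E (p' ∙ q') uz = mu1 E p' uz ∙ mu1 E q' uz.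
  by rewrite -{1}[uz](seqa_idr _ (Phi0 E (G0 (F0 z)))) bf_seqa //; exact: Hu.
have Nx := F2_naturalE G (idt (Phi0 D (F0 x))) (F2 F y z).
have Nz := F2_naturalE G (F2 F x y) (idt (Phi0 D (F0 z))).
rewrite !src_idt !tgt_idt !src_F2 !tgt_F2 !lf_idt -!hfun_Phi0 in Nx Nz.
rewrite -!hfun_Phi0.
have Hx := hexagonE G (F0 x) (F0 y) (F0 z).
rewrite !seqaA -[_ ∙ mu1 E ux q ∙ _]seqaA Nx !seqaA Hx.
rewrite -[_ ∙ mu1 E q' uz ∙ _]seqaA Nz -!seqaA -!lf_seqa.
by rewrite !seqaA hexagonE.
Defined.

Lemma hass2_compE x y :
  F2 hass2_comp x y = F2 G (F0 x) (F0 y) ∙ G1 (F2 F x y).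
Proof. exact: compE. Qed.

End Comp.

Lemma hass2_comp_idl (C D : hass2) (F : hass2_hom C D) :
  hass2_comp (hass2_id D) F = F.
Proof.
apply: hass2_hom_ext => // x y; rewrite hass2_compE.
by rewrite [F2 (hass2_id D) _ _]hass2_id_F2 seqa_idl // src_F2.
Qed.

Lemma hass2_comp_idr (C D : hass2) (F : hass2_hom C D) :
  hass2_comp F (hass2_id C) = F.
Proof.
apply: hass2_hom_ext => // x y; rewrite hass2_compE.
by rewrite [F2 (hass2_id C) _ _]hass2_id_F2 lf_idt seqa_idr.
Qed.

Lemma hass2_compA (A B C D : hass2) (H : hass2_hom C D) (G : hass2_hom B C)
    (F : hass2_hom A B) :
  hass2_comp H (hass2_comp G F) = hass2_comp (hass2_comp H G) F.
Proof.
by apply: hass2_hom_ext => // x y; rewrite !hass2_compE lf_seqa seqaA.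
Qed.

Definition HAss2_category : category :=
  Category hass2_comp_idl hass2_comp_idr hass2_compA.

End HAss2.

(* Main.v *)
(* A 2-term algebra A is realized as the hom-associative 2-algebra with objects
   A_0 and arrows A_0 x A_1, where (a, m) goes from a to a + d m, composition
   adds the second components, and the associator at (x, y, z) has second
   component - mu_3(x, y, z).  Linearity forces a functor between two
   realizations to act componentwise on arrows, and a transformation
   F_2(x, y) : mu(F x, F y) -> F mu(x, y) is the same as its second component,
   so realization is fully faithful.  Conversely, a hom-associative 2-algebra C
   is strictly isomorphic to the realization of the 2-term algebra with A_1 the
   kernel of the source map and d the target map, through (x, m) |-> 1_x + m. *)

From HB Require Import structures.
From mathcomp Require Import all_boot all_algebra.
From mathcomp Require Import boolp reals.
Require Import Defs.

Set Implicit Arguments.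
Unset Strict Implicit.
Unset Printing Implicit Defensive.

Import GRing.Theory.
Local Open Scope ring_scope.

(** * Fully faithful, essentially surjective functors are equivalences *)

Lemma fully_faithful_reflects_iso (C D : category) (T : functor C D) (a b : C)
    (f : hom a b) :
  (forall a b : C, injective (@fmap C D T a b)) ->
  (forall (a b : C) (h : hom (T a) (T b)), exists f, fmap T f = h) ->
  is_iso (fmap T f) -> is_iso f.
Proof.
move=> faith full [h [hf fh]]; have [g Eg] := full _ _ h.
by exists g; split; apply: faith; rewrite fmap_comp fmap_id Eg.
Qed.

(** Choice picks a preimage [G0 x] with an isomorphism [e x]. An inverse functor must send [h] to
    the unique preimage under [T] of its conjugate by [e]; uniqueness makes this functorial and [e]
    natural. *)
Lemma fully_faithful_equivalence (C D : category) (T : functor C D) :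
  (forall a b : C, injective (@fmap C D T a b)) ->
  (forall (a b : C) (h : hom (T a) (T b)), exists f, fmap T f = h) ->
  (forall x : D, exists (a : C) (e : hom (T a) x), is_iso e) ->
  equivalent_categories C D.
Proof.
move=> faith full surj.
pose lift a b h := projT1 (cid (full a b h)).
have liftK a b h : fmap T (lift a b h) = h := projT2 (cid (full a b h)).
pose G0 x := projT1 (cid (surj x)).
have [e e_iso] : {e : forall x, hom (T (G0 x)) x | forall x, is_iso (e x)}.
  exists (fun x => projT1 (cid (projT2 (cid (surj x))))) => x.
  exact: (projT2 (cid (projT2 (cid (surj x))))).
pose e' x : hom x (T (G0 x)) := projT1 (cid (e_iso x)).
have e'e x : compm (e' x) (e x) = idm _ := (projT2 (cid (e_iso x))).1.
have ee' x : compm (e x) (e' x) = idm _ := (projT2 (cid (e_iso x))).2.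
pose G1 x y (h : hom x y) : hom (G0 x) (G0 y) :=
  lift _ _ (compm (e' y) (compm h (e x))).
have TG1 x y (h : hom x y) : fmap T (G1 x y h) = compm (e' y) (compm h (e x)).
  exact: liftK.
clearbody lift e' G1.
have G1_id x : G1 x x (idm x) = idm (G0 x).
  by apply: faith; rewrite TG1 fmap_id compm_idl e'e.
have G1_comp x y z (h' : hom y z) (h : hom x y) :
    G1 x z (compm h' h) = compm (G1 y z h') (G1 x y h).
  apply: faith; rewrite fmap_comp !TG1 -!compmA; congr compm; congr compm.
  by rewrite [in RHS]compmA ee' compm_idl.
exists T, (Functor G1_id G1_comp); split.
(* The component at [a] is the preimage of [e (T a)]; it is invertible because [T] reflects
   isomorphisms. *)
- exists (fun a => lift _ _ (e (T a))); split => [a|a b f] /=.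
    by apply: (fully_faithful_reflects_iso faith full); rewrite liftK.
  by apply: faith; rewrite !fmap_comp !liftK TG1 compmA ee' compm_idl.
- exists e; split=> // x y h /=.
  by rewrite TG1 compmA ee' compm_idl.
Qed.

(* Cancels opposite terms: the last summand is matched by commuting its
   opposite to the end of the sum. *)
Ltac abelian :=
  apply/eqP; rewrite -subr_eq0; apply/eqP;
  rewrite -[LHS]add0r ?(opprD, opprK, oppr0, addr0, addrA);
  repeat match goal with
  | |- _ + - ?y = 0 => rewrite ?(addrAC _ y) addrNK
  | |- _ + ?y = 0 => rewrite ?(addrAC _ (- y)) addrK
  end; reflexivity.

Lemma linear_morphD (K : fieldType) (U V : lmodType K) (f : U -> V) :
  linear f -> {morph f : u v / u + v}.
Proof. by move=> fL u v; rewrite -[u in LHS]scale1r fL scale1r. Qed.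

Lemma linear_morph0 (K : fieldType) (U V : lmodType K) (f : U -> V) :
  linear f -> f 0 = 0.
Proof.
by move=> fL; rewrite -[0 in LHS](addNr 0) -scaleN1r fL scaleN1r addNr.
Qed.

(** * Realization of a 2-term algebra as a hom-associative 2-algebra *)

Section TwoTermToCategory.
Variables (K : fieldType) (A : HA2 K).

Definition arrows : lmodType K := (A0 A * A1 A)%type.

Definition arrow_tgt_fun (f : arrows) : A0 A := f.1 + d f.2.

Lemma arrow_tgt_linear : linear arrow_tgt_fun.
Proof.
by move=> k f g; rewrite /arrow_tgt_fun /= linearP /= scalerDr addrACA.
Qed.

HB.instance Definition _ :=
  GRing.isLinear.Build K arrows (A0 A) *:%R arrow_tgt_fun arrow_tgt_linear.

Definition arrow_idt_fun (x : A0 A) : arrows := (x, 0).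

Lemma arrow_idt_linear : linear arrow_idt_fun.
Proof. by move=> k x y; congr pair; rewrite /= scaler0 addr0. Qed.

HB.instance Definition _ :=
  GRing.isLinear.Build K (A0 A) arrows *:%R arrow_idt_fun arrow_idt_linear.

Definition arrow_src : {linear arrows -> A0 A} := @fst _ _.
Definition arrow_tgt : {linear arrows -> A0 A} := arrow_tgt_fun.
Definition arrow_idt : {linear A0 A -> arrows} := arrow_idt_fun.

Definition arrow_comp (f g : arrows) (_ : arrow_tgt f = arrow_src g) : arrows :=
  (f.1, f.2 + g.2).

Definition category_of : two_vect K.
Proof.
apply: (@TwoVect K _ _ arrow_src arrow_tgt arrow_idt arrow_comp) => //=.
- move=> k f g f' g' H H' H''; congr pair => /=.
  by rewrite scalerDr addrACA.
- by move=> x; rewrite /arrow_tgt_fun /= linear0 addr0.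
- by move=> f g; rewrite /arrow_tgt_fun /= => <-; rewrite linearD addrA.
- by move=> [x m] H; rewrite /arrow_comp /= add0r.
- by move=> [x m] H; rewrite /arrow_comp /= addr0.
- by move=> f g h *; rewrite /arrow_comp /= addrA.
Defined.

(* The second component is mu01 a n + mu10 m b + mu01 (d m) n for f = (a, m) and
   g = (b, n); the last two terms are grouped by [mu_d]. *)
Definition arrow_mul_fun (f g : ar category_of) : ar category_of :=
  (mu00 f.1 g.1, mu01 f.1 g.2 + mu10 f.2 (tgt g)).

Lemma arrow_mul_bilinear : bilinear_for *:%R *:%R arrow_mul_fun.
Proof.
split=> f k g h; congr pair; rewrite /= ?(linearPl, linearPr) //=.
  by rewrite scalerDr addrACA.
by rewrite [arrow_tgt_fun _]linearP linearPr /= scalerDr addrACA.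
Qed.

Definition arrow_mul :
    {bilinear ar category_of -> ar category_of -> ar category_of} :=
  HB.pack arrow_mul_fun
    (@bilinear_isBilinear.Build K _ _ _ *:%R *:%R _ arrow_mul_bilinear).

Lemma arrow_tgtE (f : ar category_of) : tgt f = f.1 + d f.2.
Proof. by []. Qed.

Lemma arrow_mulE (f g : ar category_of) :
  arrow_mul f g = (mu00 f.1 g.1, mu01 f.1 g.2 + mu10 f.2 (tgt g)).
Proof. by []. Qed.

Lemma tgt_arrow_mul (f g : ar category_of) :
  tgt (arrow_mul f g) = mu00 (tgt f) (tgt g).
Proof.
rewrite arrow_mulE !arrow_tgtE /= linearD /= d_mu01 d_mu10 addrA -linearDr /=.
by rewrite [RHS]linearDl.
Qed.

Definition mul_of : bilinear_functor category_of category_of category_of.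
Proof.
apply: (@BilinearFunctor K _ _ _
  (@mu00 K A : {bilinear ob category_of -> ob category_of -> ob category_of})
  arrow_mul) => //.
- exact: tgt_arrow_mul.
- by move=> x y; rewrite arrow_mulE /= linear0r linear0l addr0.
- move=> f f' g g' Hf Hg H; rewrite !arrow_mulE tgt_comp; congr pair => /=.
  (* Interchange: composability moves the source of [f'] by [d f.2] and the target of [g] by
     [d g'.2]. The two resulting corrections, [mu01 (d f.2) g'.2] and [mu10 f.2 (d g'.2)], agree by
     [mu_d]. *)
  have Ef : f'.1 = f.1 + d f.2 by rewrite -[LHS]Hf.
  have Eg : tgt g' = tgt g + d g'.2 by rewrite Hg.
  rewrite Ef linearDr linearDl [mu01 (_ + _) _]linearDl /= mu_d.
  rewrite {1}Eg linearDr /= !addrA.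
  by rewrite [LHS](ACl (1*3*2*4*5)).
Defined.

Lemma mu_ofE (f g : ar category_of) : bf1 mul_of f g = arrow_mul f g.
Proof. by []. Qed.

Definition arrow_alpha_fun (f : ar category_of) : ar category_of :=
  (alpha0 f.1, alpha1 f.2).

Lemma arrow_alpha_linear : linear arrow_alpha_fun.
Proof. by move=> k f g; congr pair; rewrite /= linearP. Qed.

HB.instance Definition _ := GRing.isLinear.Build K (ar category_of)
  (ar category_of) *:%R arrow_alpha_fun arrow_alpha_linear.

Definition arrow_alpha : {linear ar category_of -> ar category_of} :=
  arrow_alpha_fun.

Definition Phi_of : linear_functor category_of category_of.
Proof.
apply: (@LinearFunctor K _ _
  (@alpha0 K A : {linear ob category_of -> ob category_of})
  arrow_alpha) => //.
- by move=> f; rewrite !arrow_tgtE /= linearD /= alpha_d.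
- by move=> x; congr pair; rewrite /= linear0.
- by move=> f g H H'; congr pair; rewrite /= linearD.
Defined.

(** The sign is forced: by [d_mu3], [d (mu3 x y z)] is the source of the associator minus its
    target. *)
Definition assoc_of (x y z : ob category_of) : ar category_of :=
  (mu00 (mu00 x y) (alpha0 z), - mu3 x y z).

Definition hass2_data_of : hass2_data K.
Proof.
apply: (@HAss2Data K category_of mul_of Phi_of assoc_of) => //.
- by move=> x y; exact: alpha_mu00.
- move=> f g; congr pair; first exact: alpha_mu00.
  rewrite [LHS]linearD /= alpha_mu01 alpha_mu10; congr (_ + mu10 _ _).
  exact: esym (tgt_lf Phi_of g).
- move=> x y z; rewrite arrow_tgtE /= linearN /= d_mu3 opprB addrC subrK //.
Defined.

Lemma mu3Dl (x x' y z : A0 A) : mu3 (x + x') y z = mu3 x y z + mu3 x' y z.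
Proof.
by case: (mu3_trilinear A) => L _ _; exact: linear_morphD (L y z) x x'.
Qed.

Lemma mu3Dm (x y y' z : A0 A) : mu3 x (y + y') z = mu3 x y z + mu3 x y' z.
Proof.
by case: (mu3_trilinear A) => _ L _; exact: linear_morphD (L x z) y y'.
Qed.

Lemma mu3Dr (x y z z' : A0 A) : mu3 x y (z + z') = mu3 x y z + mu3 x y z'.
Proof.
by case: (mu3_trilinear A) => _ _ L; exact: linear_morphD (L x y) z z'.
Qed.

Lemma assoc_of_trilinear : trilinear assoc_of.
Proof.
case: (mu3_trilinear A) => L1 L2 L3; split=> u v k w w'; rewrite /assoc_of.
- by congr pair; rewrite /= ?linearPl ?L1 ?opprD ?scalerN /= ?linearPl.
- by congr pair; rewrite /= ?linearPr ?L2 ?opprD ?scalerN /= ?linearPl.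
- by congr pair; rewrite /= ?linearP ?L3 ?opprD ?scalerN /= ?linearPr.
Qed.

Lemma assoc_of_natural (f g h : ar hass2_data_of) :
    comp (mu1 hass2_data_of (mu1 hass2_data_of f g) (Phi1 hass2_data_of h))
           (assoc (tgt f) (tgt g) (tgt h)) (assoc_natural_l f g h)
    = comp (assoc (src f) (src g) (src h))
           (mu1 hass2_data_of (Phi1 hass2_data_of f) (mu1 hass2_data_of g h))
           (assoc_natural_r f g h).
Proof.
congr pair; rewrite !mu_ofE !arrow_mulE !tgt_arrow_mul tgt_lf /=.
case: f g h => [a m] [b n] [c p] /=.
(* The arguments of [mu3] pass from sources to targets one at a time, last slot first; each
   correction is the axiom for a boundary [d] in that slot. *)
have E3 : mu3 a b (c + d p) = mu3 a b c
    + (mu01 (mu00 a b) (alpha1 p) - mu01 (alpha0 a) (mu01 b p)).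
  by rewrite mu3Dr mu3_d3.
have E2 : mu3 a (b + d n) (c + d p) = mu3 a b (c + d p)
    + (mu10 (mu01 a n) (alpha0 (c + d p)) - mu01 (alpha0 a) (mu10 n (c + d p))).
  by rewrite mu3Dm mu3_d2.
rewrite /arrow_tgt_fun /= mu3Dl mu3_d1 E2 E3.
rewrite [mu10 (_ + _) _]linearDl [mu01 _ (_ + _)]linearDr /=.
abelian.
Qed.

Lemma assoc_of_invertible (x y z : ob hass2_data_of) :
  invertible (assoc x y z : ar hass2_data_of).
Proof.
pose g : ar hass2_data_of := (mu00 (alpha0 x) (mu00 y z), mu3 x y z).
have H : tgt (assoc x y z : ar hass2_data_of) = src g by rewrite tgt_assoc.
have H' : tgt g = src (assoc x y z : ar hass2_data_of).
  by rewrite arrow_tgtE src_assoc d_mu3 addrC subrK.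
exists g, H, H'; split; congr pair; rewrite ?addNr ?addrN //.
Qed.

Definition hass2_of : hass2 K.
Proof.
apply: (@HAss2 K hass2_data_of).
(* The map [alpha1] is recovered from [Phi] on the arrows [(0, m)]. *)
- case=> [P0 P1]; apply: (@alpha_neq0 K A); split=> [x|m]; first exact: P0.
  by have := P1 (0, m) => /(congr1 snd).
- exact: assoc_of_trilinear.
- exact: assoc_of_natural.
- exact: assoc_of_invertible.
- move=> x y z; congr pair; rewrite /= ?linearN /= ?alpha_mu3 //.
  by rewrite !alpha_mu00.
- move=> x y z w; congr pair => /=.
  (* On second components the pentagon is, up to sign, [mu3_coherence], solved here for one term so
     that it can be substituted. *)
  have P : mu10 (mu3 x y z) (alpha0 (alpha0 w)) =
      mu3 (mu00 x y) (alpha0 z) (alpha0 w)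
      - mu3 (alpha0 x) (mu00 y z) (alpha0 w)
      + mu3 (alpha0 x) (alpha0 y) (mu00 z w)
      - mu01 (alpha0 (alpha0 x)) (mu3 y z w).
    by rewrite mu3_coherence addrK.
  rewrite {1}/arrow_tgt_fun /= !linear0 addr0 linear0l linearNl linearNr /= P.
  abelian.
Defined.

End TwoTermToCategory.

(** * Realization of morphisms *)

Section HomToFunctor.
Variables (K : fieldType) (A B : HA2 K) (f : HA2_hom A B).

Definition arrow_map_fun (p : ar (hass2_of A)) : ar (hass2_of B) :=
  (f0 f p.1, f1 f p.2).

Lemma arrow_map_linear : linear arrow_map_fun.
Proof. by move=> k p q; congr pair; rewrite /= linearP. Qed.

HB.instance Definition _ := GRing.isLinear.Build K (ar (hass2_of A))
  (ar (hass2_of B)) *:%R arrow_map_fun arrow_map_linear.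

Definition arrow_map : {linear ar (hass2_of A) -> ar (hass2_of B)} :=
  arrow_map_fun.

Definition functor_of : linear_functor (hass2_of A) (hass2_of B).
Proof.
apply: (@LinearFunctor K (hass2_of A) (hass2_of B)
  (f0 f : {linear ob (hass2_of A) -> ob (hass2_of B)}) arrow_map) => //.
- by move=> p; rewrite !arrow_tgtE /= linearD /= hom_d.
- by move=> x; congr pair; rewrite /= linear0.
- by move=> p q H H'; congr pair; rewrite /= linearD.
Defined.

Definition transf_of_fun (x y : ob (hass2_of A)) : ar (hass2_of B) :=
  (mu00 (f0 f x) (f0 f y), f2 f x y).

Lemma transf_of_bilinear : bilinear_for *:%R *:%R transf_of_fun.
Proof.
by split=> x k y z; congr pair; rewrite /= ?linearP /= ?(linearPl, linearPr).
Qed.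

Definition transf_of :
    {bilinear ob (hass2_of A) -> ob (hass2_of A) -> ar (hass2_of B)} :=
  HB.pack transf_of_fun
    (@bilinear_isBilinear.Build K _ _ _ *:%R *:%R _ transf_of_bilinear).

Definition hass2_hom_data_of : hass2_hom_data (hass2_of A) (hass2_of B).
Proof.
apply: (@HAss2HomData K (hass2_of A) (hass2_of B) functor_of transf_of) => //.
- by move=> x; exact: hom_alpha0.
- by move=> p; congr pair; [exact: hom_alpha0|exact: hom_alpha1].
- by move=> x y; rewrite arrow_tgtE /= d_f2 addrC subrK.
Defined.

Definition hass2_hom_of : hass2_hom (hass2_of A) (hass2_of B).
Proof.
apply: (@HAss2Hom K _ _ hass2_hom_data_of).
- move=> [a m] [b n]; congr pair.
  have E : arrow_tgt_fun (f0 f b, f1 f n) = f0 f (b + d n) :=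
    tgt_lf functor_of (b, n).
  rewrite /= /arrow_map_fun /= E /arrow_tgt_fun /=.
  (* Passing from sources to targets changes [f2] by its values on boundaries, which [f2_d1] and
     [f2_d2] express as the failure of [f1] to preserve the products. *)
  rewrite [f2 f (_ + _) _]linearDl f2_d1 [f2 f a _]linearDr /= f2_d2.
  rewrite [f1 f (_ + _)]linearD /=; abelian.
- move=> x y; congr pair; rewrite /= ?hom_alpha2 //.
  by rewrite alpha_mu00 !hom_alpha0.
- move=> x y z; congr pair => /=.
  rewrite {2}/arrow_tgt_fun /= !linear0 linear0l !(addr0, add0r) linearN /=.
  (* The second component of the hexagon is [f2_coherence], solved for the term in [f1]. *)
  have -> : f1 f (mu3 x y z) = f2 f (mu00 x y) (alpha0 z)
      - f2 f (alpha0 x) (mu00 y z) + mu10 (f2 f x y) (alpha0 (f0 f z))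
      - mu01 (alpha0 (f0 f x)) (f2 f y z) + mu3 (f0 f x) (f0 f y) (f0 f z).
    by rewrite f2_coherence subrK.
  abelian.
Defined.

End HomToFunctor.

(** * Realization is a fully faithful functor *)

Section FunctorFromCategory.
Variable K : fieldType.

Lemma hass2_hom_of_id (A : HA2 K) :
  hass2_hom_of (HA2_id A) = hass2_id (hass2_of A).
Proof. by apply: hass2_hom_ext => // -[]. Qed.

Lemma hass2_hom_of_comp (A B C : HA2 K) (g : HA2_hom B C) (f : HA2_hom A B) :
  hass2_hom_of (HA2_comp g f) = hass2_comp (hass2_hom_of g) (hass2_hom_of f).
Proof. by apply: hass2_hom_ext => // x y; congr pair. Qed.

Definition realization : functor (HA2_category K) (HAss2_category K) :=
  @Functor (HA2_category K) (HAss2_category K) (@hass2_of K) (@hass2_hom_of K)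
    hass2_hom_of_id hass2_hom_of_comp.

Lemma realization_faithful (A B : HA2_category K) :
  injective (@fmap _ _ realization A B).
Proof.
move=> f g; pose H := hass2_hom (hass2_of A) (hass2_of B).
move=> E; apply: HA2_hom_ext => [x|m|x y].
- by have := congr1 (fun F : H => lf0 (hfun F) x) E.
- by have := congr1 (fun F : H => (lf1 (hfun F) (0, m)).2) E.
- by have := congr1 (fun F : H => (F2 F x y).2) E.
Qed.

Section Full.
Variables (A B : HA2 K) (F : hass2_hom (hass2_of A) (hass2_of B)).

(** The arrows out of 0 form a copy of [A1 C] inside the arrows; they are used to extract the degree
    1 data of a functor. *)
Definition inner_arrow (C : HA2 K) (m : A1 C) : ar (hass2_of C) := (0, m).

Definition fiber_map_fun (m : A1 A) : A1 B := (lf1 (hfun F) (inner_arrow m)).2.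

Lemma inner_arrow_linear (C : HA2 K) : linear (@inner_arrow C).
Proof. by move=> k m n; congr pair; rewrite /= scaler0 addr0. Qed.

Lemma fiber_map_linear : linear fiber_map_fun.
Proof. by move=> k m n; rewrite /fiber_map_fun inner_arrow_linear linearP. Qed.

HB.instance Definition _ :=
  GRing.isLinear.Build K (A1 A) (A1 B) *:%R fiber_map_fun fiber_map_linear.

Definition fiber_map : {linear A1 A -> A1 B} := fiber_map_fun.

Definition ob_map : {linear A0 A -> A0 B} := lf0 (hfun F).

(** Every arrow is an identity plus an arrow out of 0. A linear functor preserves identities and
    sends arrows out of 0 to arrows out of 0, so it acts componentwise. *)
Lemma lf1E (p : ar (hass2_of A)) :
  lf1 (hfun F) p = (ob_map p.1, fiber_map p.2).
Proof.
case: p => x m; have S := src_lf (hfun F) (inner_arrow m : ar (hass2_of A)).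
have -> : (x, m) = idt (x : ob (hass2_of A)) + inner_arrow m
    :> ar (hass2_of A).
  by congr pair; rewrite /= ?addr0 ?add0r.
rewrite linearD /= lf_idt; congr pair.
  by rewrite /= [X in _ + X]S /= linear0 !addr0.
by rewrite /= !add0r.
Qed.

Definition fiber_transf_fun (x y : A0 A) : A1 B := (F2 F x y).2.

Lemma fiber_transf_bilinear : bilinear_for *:%R *:%R fiber_transf_fun.
Proof.
by split=> x k y z; rewrite /fiber_transf_fun /= ?(linearPl, linearPr).
Qed.

Definition fiber_transf : {bilinear A0 A -> A0 A -> A1 B} :=
  HB.pack fiber_transf_fun
    (@bilinear_isBilinear.Build K _ _ _ *:%R *:%R _ fiber_transf_bilinear).

Lemma F2E (x y : A0 A) :
  F2 F x y = (mu00 (ob_map x) (ob_map y), fiber_transf x y).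
Proof.
have S := src_F2 F x y.
by rewrite [LHS]surjective_pairing; congr pair; exact: S.
Qed.

Lemma tgt_arrow_idt (C : HA2 K) (x : A0 C) :
  arrow_tgt_fun (arrow_idt_fun x) = x.
Proof. by rewrite /arrow_tgt_fun /= linear0 addr0. Qed.

Lemma tgt_inner_arrow (C : HA2 K) (m : A1 C) :
  arrow_tgt_fun (inner_arrow m) = d m.
Proof. exact: add0r. Qed.

Definition hom_from : HA2_hom A B.
Proof.
apply: (@MakeHA2Hom K A B ob_map fiber_map fiber_transf).
- move=> m; have := tgt_lf (hfun F) (inner_arrow m : ar (hass2_of A)).
  by rewrite lf1E /= /arrow_tgt_fun /= linear0 !add0r => ->.
- exact: (hfun_Phi0 F).
- move=> m; have := hfun_Phi1 F (inner_arrow m : ar (hass2_of A)).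
  by rewrite !lf1E => /(congr1 snd).
- by move=> x y; have := F2_Phi F x y => /(congr1 snd).
- move=> x y; have := tgt_F2 F x y; rewrite F2E arrow_tgtE /= => <-.
  by rewrite addrC addKr.
(* Naturality at an identity and an arrow out of 0: the transformation at the sources vanishes
   because one argument is 0, which leaves the formula for [f2] on a boundary. The next case is
   symmetric. *)
- move=> x m; have := F2_natural F (idt (x : ob (hass2_of A))) (inner_arrow m).
  move=> /(congr1 snd) /=; rewrite !lf1E /= tgt_arrow_idt tgt_inner_arrow.
  rewrite !linear0 !linear0l !addr0 /= add0r => <-.
  by rewrite addrC addKr.
- move=> m x; have := F2_natural F (inner_arrow m) (idt (x : ob (hass2_of A))).
  move=> /(congr1 snd) /=; rewrite !lf1E /= tgt_arrow_idt tgt_inner_arrow.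
  rewrite /arrow_tgt_fun /= !linear0 !linear0l !addr0 /= !add0r => <-.
  by rewrite addrC addKr.
- move=> x y z; have := hexagon F x y z.
  move=> /(congr1 snd) /=; rewrite !lf1E /= tgt_arrow_idt.
  rewrite !linear0 linear0l addr0 add0r linearN /= => E.
  (* Both identities become vanishing differences; swapping the sides of [E] makes their signs
     agree. *)
  apply: subr0_eq; move/eqP: E; rewrite eq_sym -subr_eq0 => /eqP E.
  rewrite -[RHS]E /fiber_transf_fun /ob_map; abelian.
Defined.

End Full.

Lemma realization_full (A B : HA2_category K)
    (F : hom (realization A) (realization B)) :
  exists f, fmap realization f = F.
Proof.
exists (hom_from F); apply: hass2_hom_ext => [x|p|x y] //.
  exact: esym (lf1E F p).
exact: esym (F2E F x y).
Qed.

End FunctorFromCategory.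

(** * Strict morphisms and strict isomorphisms of hom-associative 2-algebras *)

Section StrictIsomorphism.
Variables (K : fieldType) (C D : hass2 K) (F : linear_functor C D).
Hypothesis F_Phi0 : forall x, Phi0 D (lf0 F x) = lf0 F (Phi0 C x).
Hypothesis F_Phi1 : forall f, Phi1 D (lf1 F f) = lf1 F (Phi1 C f).
Hypothesis F_mu0 : forall x y, mu0 D (lf0 F x) (lf0 F y) = lf0 F (mu0 C x y).
Hypothesis F_mu1 : forall f g, mu1 D (lf1 F f) (lf1 F g) = lf1 F (mu1 C f g).
Hypothesis F_assoc : forall x y z,
  assoc (lf0 F x) (lf0 F y) (lf0 F z) = lf1 F (assoc x y z).

(** Since [F] preserves the product on the nose, identity arrows can serve as [F2]; the hexagon then
    collapses to [F_assoc]. *)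
Definition strict_hom_data : hass2_hom_data C D.
Proof.
apply: (@HAss2HomData K C D F (lin_bilin (idt \o lf0 F) (mu0 C))) => // x y.
  by rewrite [LHS]src_idt F_mu0.
exact: tgt_idt.
Defined.

Lemma strict_hom_F2 x y : F2 strict_hom_data x y = idt (lf0 F (mu0 C x y)).
Proof. by []. Qed.

Definition strict_hom : hass2_hom C D.
Proof.
apply: (@HAss2Hom K C D strict_hom_data).
- move=> f g; rewrite !compE !strict_hom_F2 seqa_idr seqa_idl ?F_mu1 //.
  by rewrite src_lf src_bf.
- by move=> x y; rewrite !strict_hom_F2 lf_idt F_Phi0 Phi_mu0.
- move=> x y z; rewrite /comp3 !compE !strict_hom_F2 /= !F_Phi0 -!F_mu0 !bf_idt.
  rewrite !seqa_idr F_assoc seqa_idl //.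
  by rewrite src_lf src_assoc -!F_mu0.
Defined.

Lemma strict_homE x y : F2 strict_hom x y = idt (lf0 F (mu0 C x y)).
Proof. by []. Qed.

End StrictIsomorphism.

(** Strictness passes to the inverse by cancellation, and the [F2] of each composite is again made
    of identity arrows, as in the identity morphism. *)
Lemma strict_iso (K : fieldType) (C D : hass2 K) (F : linear_functor C D)
    (G : linear_functor D C) :
  (forall x, Phi0 D (lf0 F x) = lf0 F (Phi0 C x)) ->
  (forall f, Phi1 D (lf1 F f) = lf1 F (Phi1 C f)) ->
  (forall x y, mu0 D (lf0 F x) (lf0 F y) = lf0 F (mu0 C x y)) ->
  (forall f g, mu1 D (lf1 F f) (lf1 F g) = lf1 F (mu1 C f g)) ->
  (forall x y z, assoc (lf0 F x) (lf0 F y) (lf0 F z) = lf1 F (assoc x y z)) ->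
  cancel (lf0 F) (lf0 G) -> cancel (lf0 G) (lf0 F) ->
  cancel (lf1 F) (lf1 G) -> cancel (lf1 G) (lf1 F) ->
  exists f : hom (C : HAss2_category K) D, is_iso f.
Proof.
move=> P0 P1 M0 M1 As F0K G0K F1K G1K.
have gP0 x : Phi0 C (lf0 G x) = lf0 G (Phi0 D x).
  by rewrite -[LHS]F0K -P0 G0K.
have gP1 f : Phi1 C (lf1 G f) = lf1 G (Phi1 D f).
  by rewrite -[LHS]F1K -P1 G1K.
have gM0 x y : mu0 C (lf0 G x) (lf0 G y) = lf0 G (mu0 D x y).
  by rewrite -[LHS]F0K -M0 !G0K.
have gM1 f g : mu1 C (lf1 G f) (lf1 G g) = lf1 G (mu1 D f g).
  by rewrite -[LHS]F1K -M1 !G1K.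
have gAs x y z : assoc (lf0 G x) (lf0 G y) (lf0 G z) = lf1 G (assoc x y z).
  by rewrite -[LHS]F1K -As !G0K.
exists (strict_hom P0 P1 M0 M1 As), (strict_hom gP0 gP1 gM0 gM1 gAs).
split; apply: hass2_hom_ext => // x y; rewrite hass2_compE !strict_homE /=.
  by rewrite lf_idt F0K seqa_idr -gM0 !F0K.
by rewrite lf_idt G0K seqa_idr -M0 !G0K.
Qed.

(** * The 2-term algebra on the kernel of the source map; essential surjectivity *)

Section SourceKernel.
Variables (K : fieldType) (C : hass2 K).

Definition src_ker : {pred ar C} := fun f => src f == 0.

Lemma src_ker_submod_closed : submod_closed src_ker.
Proof.
split=> [|k f g]; rewrite !unfold_in /= ?linear0 //.
by move=> /eqP f0 /eqP g0; rewrite linearP /= f0 g0 scaler0 addr0.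
Qed.

HB.instance Definition _ :=
  GRing.isSubmodClosed.Build K (ar C) src_ker src_ker_submod_closed.

Record fiber := Fiber { fiber_val : ar C; fiberP : fiber_val \in src_ker }.

HB.instance Definition _ := [isSub for fiber_val].
HB.instance Definition _ := [Choice of fiber by <:].
HB.instance Definition _ := [SubChoice_isSubLmodule of fiber by <:].

Lemma src_fiber (m : fiber) : src (val m) = 0.
Proof. exact/eqP/(fiberP m). Qed.

Definition in_fiber (f : ar C) (f0 : src f = 0) : fiber :=
  Fiber (introT eqP f0).

Lemma idt0 : idt 0 = 0 :> ar C.
Proof. exact: linear0. Qed.

(* Interchange law for f = 1_0 ; f = f ; 1_(tgt f) and likewise for g. *)
Lemma mul_fiber_l (f g : ar C) : src f = 0 -> src g = 0 ->
  mu1 C f g = mu1 C f (idt (tgt g)).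
Proof.
move=> f0 g0; rewrite -[in LHS](seqa_idl f0) -[in LHS](seqa_idr g (tgt g)).
rewrite bf_seqa ?tgt_idt ?src_idt // idt0 linear0l /seqa add0r.
by rewrite src_bf f0 linear0l linear0 subr0.
Qed.

Lemma mul_fiber_r (f g : ar C) : src f = 0 -> src g = 0 ->
  mu1 C f g = mu1 C (idt (tgt f)) g.
Proof.
move=> f0 g0; rewrite -[in LHS](seqa_idl g0) -[in LHS](seqa_idr f (tgt f)).
rewrite bf_seqa ?tgt_idt ?src_idt // idt0 linear0r /seqa add0r.
by rewrite src_bf g0 linear0r linear0 subr0.
Qed.

Definition fiber_d_fun (m : fiber) : ob C := tgt (val m).
Lemma fiber_d_linear : linear fiber_d_fun.
Proof. by move=> k m n; rewrite /fiber_d_fun !linearP. Qed.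
HB.instance Definition _ :=
  GRing.isLinear.Build K fiber (ob C) *:%R fiber_d_fun fiber_d_linear.

Lemma src_mu01 (x : ob C) (m : fiber) : src (mu1 C (idt x) (val m)) = 0.
Proof. by rewrite src_bf src_fiber linear0r. Qed.
Definition fiber_mu01_fun x m := in_fiber (src_mu01 x m).
Lemma fiber_mu01_bilinear : bilinear_for *:%R *:%R fiber_mu01_fun.
Proof.
split=> x k y z; apply: val_inj => /=.
  by rewrite ?linearP /= ?(linearPl, linearPr).
by rewrite ?linearP /= ?(linearPl, linearPr).
Qed.
Definition fiber_mu01 : {bilinear ob C -> fiber -> fiber} :=
  HB.pack fiber_mu01_fun
    (@bilinear_isBilinear.Build K _ _ _ *:%R *:%R _ fiber_mu01_bilinear).

Lemma src_mu10 (m : fiber) (x : ob C) : src (mu1 C (val m) (idt x)) = 0.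
Proof. by rewrite src_bf src_fiber linear0l. Qed.
Definition fiber_mu10_fun m x := in_fiber (src_mu10 m x).
Lemma fiber_mu10_bilinear : bilinear_for *:%R *:%R fiber_mu10_fun.
Proof.
split=> x k y z; apply: val_inj => /=.
  by rewrite ?linearP /= ?(linearPl, linearPr).
by rewrite ?linearP /= ?(linearPl, linearPr).
Qed.
Definition fiber_mu10 : {bilinear fiber -> ob C -> fiber} :=
  HB.pack fiber_mu10_fun
    (@bilinear_isBilinear.Build K _ _ _ *:%R *:%R _ fiber_mu10_bilinear).

Lemma src_mu3 (x y z : ob C) :
  src (idt (mu0 C (mu0 C x y) (Phi0 C z)) - assoc x y z) = 0.
Proof. by rewrite linearB /= src_idt src_assoc subrr. Qed.
(** Subtracting the identity at its source moves the associator into the kernel; the sign is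
    opposite, to match [assoc_of]. *)
Definition fiber_mu3 x y z := in_fiber (src_mu3 x y z).

Lemma src_Phi1 (m : fiber) : src (Phi1 C (val m)) = 0.
Proof. by rewrite src_lf src_fiber linear0. Qed.
Definition fiber_alpha_fun m := in_fiber (src_Phi1 m).
Lemma fiber_alpha_linear : linear fiber_alpha_fun.
Proof. by move=> k m n; apply: val_inj; rewrite /= !linearP. Qed.
HB.instance Definition _ :=
  GRing.isLinear.Build K fiber fiber *:%R fiber_alpha_fun fiber_alpha_linear.

Lemma fiber_mu3_trilinear : trilinear fiber_mu3.
Proof.
case: (assoc_trilinear C) => L1 L2 L3.
split=> u v k w w'; apply: val_inj.
- rewrite /= L1 !linearPl linearP /= scalerBr; abelian.
- rewrite /= L2 linearPr linearPl linearP /= scalerBr; abelian.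
- rewrite /= L3 linearP linearPr linearP /= scalerBr; abelian.
Qed.

Lemma assoc0l (y z : ob C) : assoc 0 y z = 0 :> ar C.
Proof. by case: (assoc_trilinear C) => L _ _; exact: linear_morph0 (L y z). Qed.

Lemma assoc0m (x z : ob C) : assoc x 0 z = 0 :> ar C.
Proof. by case: (assoc_trilinear C) => _ L _; exact: linear_morph0 (L x z). Qed.

Lemma assoc0r (x y : ob C) : assoc x y 0 = 0 :> ar C.
Proof. by case: (assoc_trilinear C) => _ _ L; exact: linear_morph0 (L x y). Qed.

(** Common source of the three axioms for [mu3] on boundaries: the hypothesis holds by trilinearity
    as soon as one arrow starts at 0, and the other two are then taken to be identities. *)
Lemma assoc_natural_fiber (f g h : ar C) :
  assoc (src f) (src g) (src h) = 0 :> ar C ->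
  val (fiber_mu3 (tgt f) (tgt g) (tgt h))
  = mu1 C (mu1 C f g) (Phi1 C h) - mu1 C (Phi1 C f) (mu1 C g h).
Proof.
move=> A0.
have := assoc_natural f g h; rewrite !compE A0 /seqa.
(* In the right-hand composite the middle object is the target of the zero associator, so its
   identity vanishes as well. *)
rewrite -assoc_natural_r A0 !linear0 addr0 add0r => <- /=.
rewrite src_assoc; abelian.
Qed.

Definition kernel_of : HA2 K.
Proof.
apply: (@MakeHA2 K (ob C) fiber fiber_d_fun (mu0 C) fiber_mu01 fiber_mu10
  fiber_mu3 (Phi0 C) fiber_alpha_fun fiber_mu3_trilinear).
- case=> P0 P1; apply: (@Phi_neq0 K C); split=> // f.
  (* An arrow is the sum of an identity and a kernel element; if [Phi] kills both kinds, it kills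
     all arrows. *)
  have f0 : src (f - idt (src f)) = 0 by rewrite linearB /= src_idt subrr.
  have := congr1 val (P1 (in_fiber f0)).
  by rewrite /= linearB /= lf_idt P0 !linear0 ?(subr0, addr0).
- by move=> m; exact: esym (tgt_lf (Phi C) (val m)).
- move=> x y z; apply: val_inj.
  by rewrite /= linearB /= lf_idt !Phi_mu0 assoc_Phi.
- exact: Phi_mu0.
- by move=> x m; apply: val_inj; rewrite /= Phi_mu1 lf_idt.
- by move=> m x; apply: val_inj; rewrite /= Phi_mu1 lf_idt.
- by move=> x m; rewrite [LHS]tgt_bf tgt_idt.
- by move=> m x; rewrite [LHS]tgt_bf tgt_idt.
(* Both sides equal the product of the two kernel arrows themselves. *)
- move=> m n; apply: val_inj => /=.
  by rewrite -mul_fiber_r ?src_fiber // mul_fiber_l ?src_fiber.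
- by move=> x y z; rewrite [LHS]linearB /= tgt_idt tgt_assoc.
- move=> x y m; apply: val_inj.
  have := @assoc_natural_fiber (idt x) (idt y) (val m).
  rewrite src_fiber assoc0r !tgt_idt lf_idt bf_idt linearB /=; exact.
- move=> x m y; apply: val_inj.
  have := @assoc_natural_fiber (idt x) (val m) (idt y).
  rewrite src_fiber assoc0m !tgt_idt !lf_idt linearB /=; exact.
- move=> m x y; apply: val_inj.
  have := @assoc_natural_fiber (val m) (idt x) (idt y).
  rewrite src_fiber assoc0l !tgt_idt !lf_idt bf_idt linearB /=; exact.
- move=> x y z w; apply: val_inj; have := pentagon x y z w.
  (* With composites written as sums, the pentagon differs from the coherence identity only by
     identity arrows, which cancel. *)
  rewrite /comp3 !compE /seqa !src_assoc src_bf src_idt src_assoc => /eqP.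
  rewrite -subr_eq0 => /eqP E; apply: subr0_eq.
  rewrite /= [mu1 C (_ - _) _]linearBl [mu1 C _ (_ - _)]linearBr /= !bf_idt.
  by rewrite -[RHS]E; abelian.
Defined.

Definition decomp_fun (f : ar (hass2_of kernel_of)) : ar C :=
  idt f.1 + val f.2.
Lemma decomp_linear : linear decomp_fun.
Proof.
move=> k f g; rewrite /decomp_fun /= !linearP /= scalerDr.
by rewrite addrACA.
Qed.
HB.instance Definition _ := GRing.isLinear.Build K (ar (hass2_of kernel_of))
  (ar C) *:%R decomp_fun decomp_linear.

Lemma src_core (f : ar C) : src (f - idt (src f)) = 0.
Proof. by rewrite linearB /= src_idt subrr. Qed.
Definition core_fun (f : ar C) : ar (hass2_of kernel_of) :=
  (src f, in_fiber (src_core f)).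
Lemma core_linear : linear core_fun.
Proof.
move=> k f g; congr pair; first by rewrite linearP.
apply: val_inj; rewrite /= !linearP /= ?(scalerDr, scalerN); abelian.
Qed.
HB.instance Definition _ := GRing.isLinear.Build K (ar C)
  (ar (hass2_of kernel_of)) *:%R core_fun core_linear.

Lemma decompK : cancel decomp_fun core_fun.
Proof.
case=> x m; have S : src (idt x + val m) = x.
  by rewrite linearD /= src_idt src_fiber addr0.
by congr pair => //; apply: val_inj; rewrite /= S addrC addKr.
Qed.

Lemma coreK : cancel core_fun decomp_fun.
Proof. by move=> f; rewrite /decomp_fun /= addrC subrK. Qed.

Definition decomp : linear_functor (hass2_of kernel_of) C.
Proof.
apply: (@LinearFunctor K (hass2_of kernel_of) C
  (idfun : {linear ob (hass2_of kernel_of) -> ob C}) decomp_fun).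
- by case=> x m; rewrite linearD /= src_idt src_fiber addr0.
- by case=> x m; rewrite linearD /= tgt_idt.
- by move=> x; exact: addr0.
- move=> f g H H'; rewrite [RHS]compE /seqa /decomp_fun /=.
  rewrite [src (_ + _)]linearD /= src_idt src_fiber addr0.
  abelian.
Defined.

Definition core : linear_functor C (hass2_of kernel_of).
Proof.
apply: (@LinearFunctor K C (hass2_of kernel_of)
  (idfun : {linear ob C -> ob (hass2_of kernel_of)}) core_fun).
- by [].
- move=> f; rewrite arrow_tgtE /= /fiber_d_fun /= linearB /= tgt_idt.
  by rewrite addrC subrK.
- move=> x; congr pair; rewrite /= ?src_idt //.
  by apply: val_inj; rewrite /= src_idt subrr.
- move=> f g H H'; rewrite compE; congr pair => /=.
    by rewrite -(compE H) src_comp.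
  by apply: val_inj; rewrite /= -(compE H) src_comp compE /seqa; abelian.
Defined.

Lemma realization_essentially_surjective :
  exists (A : HA2_category K)
    (e : hom (realization K A) (C : HAss2_category K)),
    is_iso e.
Proof.
exists kernel_of; apply: (strict_iso (F := decomp) (G := core)) => //.
- case=> x m /=; rewrite /decomp_fun linearD /= lf_idt //.
- case=> [x m] [y n] /=; rewrite /decomp_fun /=.
  have -> : arrow_tgt_fun (y, n) = y + tgt (val n) by [].
  (* Expanding the product of two decomposed arrows leaves a term [m] times [n]. By [mul_fiber_l] it
     is [m] times the identity at the target of [n], which is the part of [mu10 m (tgt g)] coming
     from [d n]. *)
  rewrite [idt (_ + _)]linearD !linearDr /= !linearDl /= bf_idt.
  rewrite [mu1 C (fiber_val m) (fiber_val n)]mul_fiber_l ?src_fiber //.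
  abelian.
- by move=> x y z; rewrite /= /decomp_fun /= opprB addrC subrK.
- exact: decompK.
- exact: coreK.
Qed.

End SourceKernel.

Theorem theorem5p4 (R : realType) :
  equivalent_categories (HA2_category R) (HAss2_category R).
Proof.
apply: (@fully_faithful_equivalence _ _ (realization R)).
- exact: realization_faithful.
- exact: realization_full.
- exact: realization_essentially_surjective.
Qed.
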